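(* Let $a_1,\dots,a_n$ be nonnegative real numbers and $b_1,\dots,b_n$ negative real numbers. Let $A=\operatorname{diag}(a_1,\dots,a_n)$, $B=\operatorname{diag}(b_1,\dots,b_n)$, let $D$ be any $n\times n$ diagonal matrix, and let $N=\begin{bmatrix} A & D\\ D^* & B\end{bmatrix}$. Then neither $N$ nor $-N$ is positive semi-definite. Moreover, let $(d_1,\dots,d_n)$ be the diagonal entries of $D^*D$; if $a_i+b_i\ge 0$ and $a_ib_i-d_i<0$ for all $i\le n$, then $\|N\|>\|A+B\|$ for all symmetric norms.
   Context: Matrices have complex entries, and $D^*$ denotes the conjugate transpose of $D$. A symmetric norm is a unitarily invariant norm on square complex matrices, i.e. $\|UHV\|=\|H\|$ for all unitary matrices $U,V$. A symmetric norm on the space of $m\times m$ complex matrices induces a symmetric norm on $n\times n$ matrices ($n<m$) by $\|H\|=\|H\oplus 0\|$, where $H\oplus 0$ is the $m\times m$ matrix having $H$ as a diagonal block and zeros elsewhere. With this convention, norms are regarded as defined on square matrices of all sizes; in particular, $\|A+B\|$ means $\|(A+B)\oplus 0_n\|$ in the given norm on $2n\times 2n$ matrices, where $0_n$ is the $n\times n$ zero matrix.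
   Formalization: The claim that -N is not positive semi-definite is stated only when A and D are not both zero (if A = D = 0, then -N = 0 ⊕ (-B) is positive semi-definite, so the claim fails); also n ≥ 1 is assumed. *)

(* Defs.v *)
From mathcomp Require Import all_boot all_order all_algebra.
From mathcomp Require Import spectral reals complex.

Set Implicit Arguments.
Unset Strict Implicit.
Unset Printing Implicit Defensive.

Import Order.TTheory GRing.Theory Num.Theory.
Local Open Scope ring_scope.
Local Open Scope complex_scope.
Local Open Scope sesquilinear_scope.

(* In the order of [R[i]], [0 <= z] means that [z] is real and nonnegative. *)
Definition psdmx (R : realType) (m : nat) (M : 'M[R[i]]_m) : Prop :=
  M \is hermsymmx /\ forall v : 'cV[R[i]]_m, 0 <= (v^t* *m M *m v) 0 0.

(* [nu H >= 0] and [nu 0 = 0] follow from homogeneity and subadditivity. *)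
Definition is_mxnorm (R : realType) (m : nat) (nu : 'M[R[i]]_m -> R) : Prop :=
  [/\ forall H, nu H = 0 -> H = 0,
      forall (c : R[i]) H, (nu (c *: H))%:C = `|c| * (nu H)%:C
    & forall H K, nu (H + K) <= nu H + nu K].

Definition symmetric_norm (R : realType) (m : nat)
    (nu : 'M[R[i]]_m -> R) : Prop :=
  is_mxnorm nu /\
  forall U V H : 'M[R[i]]_m,
    U \is unitarymx -> V \is unitarymx -> nu (U *m H *m V) = nu H.

Definition induced_norm (R : realType) (n k : nat)
    (nu : 'M[R[i]]_(n + k) -> R) (H : 'M[R[i]]_n) : R :=
  nu (block_mx H 0 0 0).

Definition realdiag (R : realType) (n : nat) (a : 'I_n -> R) : 'M[R[i]]_n :=
  diag_mx (\row_i (a i)%:C).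

(* Main.v *)
Require Import Defs.
From mathcomp Require Import all_boot all_order all_algebra.
From mathcomp Require Import spectral reals complex.
From mathcomp Require Import ring lra.

Set Implicit Arguments.
Unset Strict Implicit.
Unset Printing Implicit Defensive.

Import Order.TTheory GRing.Theory Num.Theory.
Local Open Scope ring_scope.
Local Open Scope complex_scope.
Local Open Scope sesquilinear_scope.

(* [N] splits into the 2-by-2 matrices [a d; d^* b], each of negative
   determinant and nonnegative trace, so its eigenvalues satisfy [mu < 0] and
   [l > a + b].  Thus [A + B], padded with zeros, is [q < 1] times a diagonal
   contraction of a unitary conjugate of [N], and contractions do not increase
   a symmetric norm; strictness follows from [N <> 0]. *)

(** * Complex conjugation and adjoints of diagonal and block matrices *)

Lemma conjC_real_complex (R : realType) (x : R) : (x%:C)^*%R = x%:C.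
Proof. exact: conjc_real. Qed.

Lemma mulC_conj_real (R : realType) (z : R[i]) :
  z * z^*%R = (complex.Re z ^+ 2 + complex.Im z ^+ 2)%:C.
Proof. by rewrite add_Re2_Im2 normCK. Qed.

Lemma adjmx_diag (R : realType) n (d : 'rV[R[i]]_n) :
  (diag_mx d)^t* = diag_mx (\row_i (d 0 i)^*%R).
Proof.
rewrite tr_diag_mx map_diag_mx; congr diag_mx.
by apply/rowP => i; rewrite !mxE.
Qed.

Lemma adjmx_block (R : realType) m n p q (A : 'M[R[i]]_(m, n))
    (B : 'M[R[i]]_(m, p)) (C : 'M[R[i]]_(q, n)) (D : 'M[R[i]]_(q, p)) :
  (block_mx A B C D)^t* = block_mx (A^t*) (C^t*) (B^t*) (D^t*).
Proof. by rewrite tr_block_mx map_block_mx. Qed.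

(** * Homogeneity and positivity of matrix norms *)

Section Norm.
Variables (R : realType) (m : nat) (nu : 'M[R[i]]_m -> R).
Hypothesis nu_norm : is_mxnorm nu.

Lemma mxnormZ (c : R) H : 0 <= c -> nu (c%:C *: H) = c * nu H.
Proof.
move=> c0; case: nu_norm => _ hZ _; apply: complexI.
by rewrite hZ ger0_norm ?ler0c // rmorphM.
Qed.

Lemma mxnormN H : nu (- H) = nu H.
Proof.
case: nu_norm => _ hZ _; apply: complexI.
by rewrite -scaleN1r hZ normrN1 mul1r.
Qed.

Lemma mxnorm0 : nu 0 = 0.
Proof. by have := @mxnormZ 0 0 (lexx _); rewrite scaler0 mul0r. Qed.

Lemma mxnorm_gt0 H : H != 0 -> 0 < nu H.
Proof.
move=> H0; case: nu_norm => h0 _ hD.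
have nz : nu H != 0 by apply: contra_neq H0 => /h0.
(* Nonnegativity comes from [0 = nu (H - H) <= 2 * nu H]. *)
have := hD H (- H); rewrite subrr mxnorm0 mxnormN => ge0.
by rewrite lt_neqAle eq_sym nz /=; lra.
Qed.
End Norm.

(** * Diagonal contractions under symmetric norms *)

Lemma diag_phase_unitary (R : realType) m (w : 'rV[R[i]]_m) :
  (forall i, w 0 i * (w 0 i)^*%R = 1) -> diag_mx w \is unitarymx.
Proof.
move=> w1; apply/unitarymxP; rewrite adjmx_diag mulmx_diag.
rewrite -diag_const_mx; congr diag_mx.
by apply/rowP => i; rewrite !mxE w1.
Qed.

(* A real diagonal contraction [k] is the average of the unitary diagonal
   matrix [k + i sqrt (1 - k^2)] and its adjoint. *)
Lemma symmetric_norm_contraction (R : realType) m (nu : 'M[R[i]]_m -> R)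
    (k : 'I_m -> R) (H : 'M[R[i]]_m) :
  symmetric_norm nu -> (forall i, 0 <= k i <= 1) ->
  nu (diag_mx (\row_i (k i)%:C) *m H) <= nu H.
Proof.
move=> [nuN nuU] k01; have [_ _ nuD] := nuN.
pose w : 'rV[R[i]]_m := \row_i (k i +i* Num.sqrt (1 - k i ^+ 2)).
have w1 i : w 0 i * (w 0 i)^*%R = 1.
  have /andP[k0 k1] := k01 i.
  have k2 : 0 <= 1 - k i ^+ 2 by rewrite subr_ge0 expr_le1.
  rewrite mulC_conj_real mxE [complex.Re _]/= [complex.Im _]/=.
  by rewrite (sqr_sqrtr k2) addrC subrK.
have Wu := diag_phase_unitary w1.
have average V W : V \is unitarymx -> W \is unitarymx ->
    nu ((2^-1)%:C *: (V *m H + W *m H)) <= nu H.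
  have nuL Q : Q \is unitarymx -> nu (Q *m H) = nu H.
    move=> Qu; rewrite -[Q *m H]mulmx1; apply: (nuU _ _ _ Qu).
    by apply/unitarymxP; rewrite trmx1 map_mx1 mulmx1.
  move=> Vu Wu'; rewrite mxnormZ ?invr_ge0 //.
  have := nuD (V *m H) (W *m H); rewrite (nuL V Vu) (nuL W Wu').
  by move: (nu H) (nu _) => h g; lra.
have -> : diag_mx (\row_i (k i)%:C) *m H =
    (2^-1)%:C *: (diag_mx w *m H + (diag_mx w)^t* *m H).
  rewrite -mulmxDl scalemxAl; congr (_ *m H).
  rewrite adjmx_diag; apply/matrixP => i j; rewrite !mxE.
  case: (i == j); rewrite ?mulr0n ?addr0 ?mulr0 // !mulr1n.
  by apply/eqP; rewrite eq_complex /=; apply/andP; split; apply/eqP; field.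
by apply: (average _ _ Wu); rewrite trmxC_unitary; exact: Wu.
Qed.

(* The identities express that the unitary [c -s; s^* c] diagonalizes
   [a d; d^* b], with eigenvalues [l] and [mu]. *)
Lemma hermitian2_diag (R : realType) (a b : R) (d : R[i]) :
  0 <= a -> b < 0 -> 0 <= a + b -> (a * b)%:C - d^*%R * d < 0 ->
  exists t : R * R * R * R[i], let: (l, mu, c, s) := t in
  [/\ a + b < l, c%:C * c%:C + s * s^*%R = 1,
      a%:C * c%:C + d * s^*%R = c%:C * l%:C,
      d * c%:C - a%:C * s = - s * mu%:C &
      d^*%R * c%:C + b%:C * s^*%R = s^*%R * l%:C /\
      b%:C * c%:C - d^*%R * s = c%:C * mu%:C].
Proof.
move=> a0 b0 ab0.
set e := complex.Re d ^+ 2 + complex.Im d ^+ 2.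
have ddE : d * d^*%R = e%:C by rewrite mulC_conj_real.
rewrite [d^*%R * d]mulrC ddE -rmorphB ltcR => det0.
have e0 : 0 <= e by rewrite addr_ge0 ?sqr_ge0.
(* [q] is the square root of the discriminant of the characteristic polynomial. Since [q ^+ 2 - (a +
   b) ^+ 2 = 4 * (e - a * b) > 0], it exceeds the trace, and hence so does the larger root [l]. *)
pose q := Num.sqrt ((a - b) ^+ 2 + 4 * e).
have q0 : 0 <= q by apply: sqrtr_ge0.
have qE : q ^+ 2 = (a - b) ^+ 2 + 4 * e.
  by rewrite sqr_sqrtr // addr_ge0 ?sqr_ge0 ?mulr_ge0.
have qlt : a + b < q by rewrite -ltr_sqr ?nnegrE // qE; nra.
pose l := (a + b + q) / 2.
(* This characteristic equation and the bounds [lb] and [lab] are all that is used about [l]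
   below. *)
have lE : (l - a) * (l - b) = e.
  have -> : (l - a) * (l - b) = (q ^+ 2 - (a - b) ^+ 2) / 4.
    by rewrite /l; field.
  by rewrite qE; field.
have lb : 0 < l - b by rewrite /l; lra.
have lab : a + b < l by rewrite /l; lra.
clearbody l.
pose r := Num.sqrt ((l - b) ^+ 2 + e).
have r2 : r ^+ 2 = (l - b) ^+ 2 + e by rewrite sqr_sqrtr // addr_ge0 ?sqr_ge0.
have rn0 : r != 0.
  by rewrite -sqrf_eq0 r2 gt_eqF // ltr_pwDl ?exprn_gt0.
clearbody r.
have rC0 : r%:C != 0 by apply: contra_neq rn0 => /complexI.
have sE : (d / r%:C)^*%R = d^*%R / r%:C.
  by rewrite rmorphM -fmorphV; congr (_ * _); exact: conjC_real_complex.
have lEC : d * d^*%R = (l%:C - a%:C) * (l%:C - b%:C).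
  by rewrite ddE -lE rmorphM !rmorphB.
exists (l, a + b - l, (l - b) / r, d / r%:C) => /=.
rewrite sE !(rmorphM, rmorphB, rmorphD, fmorphV) /=.
have r2C : r%:C * r%:C = (l%:C - b%:C) ^+ 2 + d * d^*%R.
  by rewrite ddE -rmorphB -rmorphXn -rmorphD -r2 -rmorphM expr2.
split=> //; [by field: r2C | by field: lEC | by field |].
by split; field: lEC.
Qed.

(** All four blocks are diagonal, so products of such matrices are computed index by index as 2-by-2
    products, and the 2-by-2 diagonalizations assemble into a single unitary. *)
Lemma unitary_block_diag (R : realType) n (a b l mu c : 'I_n -> R)
    (d s : 'I_n -> R[i]) :
  (forall i, (c i)%:C * (c i)%:C + s i * (s i)^*%R = 1) ->
  (forall i, (a i)%:C * (c i)%:C + d i * (s i)^*%R = (c i)%:C * (l i)%:C) ->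
  (forall i, d i * (c i)%:C - (a i)%:C * s i = - s i * (mu i)%:C) ->
  (forall i,
    (d i)^*%R * (c i)%:C + (b i)%:C * (s i)^*%R = (s i)^*%R * (l i)%:C) ->
  (forall i, (b i)%:C * (c i)%:C - (d i)^*%R * s i = (c i)%:C * (mu i)%:C) ->
  exists2 U : 'M[R[i]]_(n + n), U \is unitarymx &
    U^t* *m block_mx (realdiag a) (diag_mx (\row_i d i))
                    ((diag_mx (\row_i d i))^t*) (realdiag b) *m U =
    block_mx (realdiag l) 0 0 (realdiag mu).
Proof.
move=> cs E1 E2 E3 E4.
have cJ i : ((c i)%:C)^*%R = (c i)%:C by apply: conjC_real_complex.
pose U : 'M[R[i]]_(n + n) :=
  block_mx (realdiag c) (diag_mx (\row_i - s i))
           (diag_mx (\row_i (s i)^*%R)) (realdiag c).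
have Uu : U \is unitarymx.
  apply/unitarymxP; rewrite adjmx_block mulmx_block !adjmx_diag !mulmx_diag.
  rewrite -!raddfD [RHS]scalar_mx_block -!diag_const_mx.
  (* The zero blocks become [diag_mx 0], so that all four block equations compare diagonals. *)
  rewrite -!(raddf0 (@diag_mx _ n)).
  congr block_mx; congr diag_mx; apply/rowP => i; rewrite !mxE ?cJ -?(cs i);
    rewrite ?rmorphN ?conjCK; ring.
exists U => //; rewrite -mulmxA.
(* The eigenvector equations say [N U = U L], with [L] the diagonal matrix of eigenvalues; unitarity
   then cancels [U] on the left. *)
have -> : block_mx (realdiag a) (diag_mx (\row_i d i))
      ((diag_mx (\row_i d i))^t*) (realdiag b) *m U =
    U *m block_mx (realdiag l) 0 0 (realdiag mu).
  rewrite !mulmx_block !mulmx0 !addr0 !add0r !adjmx_diag !mulmx_diag -!raddfD.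
  congr block_mx; congr diag_mx; apply/rowP => i; rewrite !mxE //.
  - by rewrite -E2; ring.
  - by rewrite -E4; ring.
rewrite mulmxA.
have /unitarymxP : U^t* \is unitarymx by rewrite trmxC_unitary.
by rewrite trmxCK => ->; rewrite mul1mx.
Qed.

(** This is the quadratic form at the vector [x e_i + y e_j]. *)
Lemma psdmx_principal2 (R : realType) m (M : 'M[R[i]]_m) (i j : 'I_m)
    (x y : R[i]) :
  psdmx M -> 0 <= x^*%R * M i i * x + x^*%R * M i j * y
                + y^*%R * M j i * x + y^*%R * M j j * y.
Proof.
move=> [_ /(_ (x *: delta_mx i 0 + y *: delta_mx j 0))].
have mulr_supp (u : 'rV[R[i]]_m) :
    (u *m (x *: delta_mx i 0 + y *: delta_mx j 0 : 'cV_m)) 0 0 =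
    u 0 i * x + u 0 j * y.
  by rewrite mulmxDr -!scalemxAr -!colE !mxE ![_ * u _ _]mulrC.
have -> : (x *: delta_mx i 0 + y *: delta_mx j 0 : 'cV[R[i]]_m)^t* =
    x^*%R *: delta_mx 0 i + y^*%R *: delta_mx 0 j.
  apply/matrixP => p q; rewrite !mxE rmorphD !rmorphM !rmorph_nat.
  by rewrite ![(p == 0) && _]andbC.
rewrite mulr_supp mulmxDl -!scalemxAl -!rowE !mxE.
congr (0 <= _); ring.
Qed.

(* The exception [A = 0 /\ D = 0] is forced: there [- N] is the diagonal matrix
   with entries [0] and [- b i > 0], which is positive semi-definite. *)
Theorem lemma2p9 (R : realType) (n : nat) (n_gt0 : (0 < n)%N)
    (a b : 'I_n -> R) (D : 'M[R[i]]_n)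
    (a_ge0 : forall i, 0 <= a i) (b_lt0 : forall i, b i < 0)
    (D_diag : is_diag_mx D) :
  let A := realdiag a in
  let B := realdiag b in
  let N := block_mx A D (D^t*) B in
  [/\ ~ psdmx N,
      ~ (A = 0 /\ D = 0) -> ~ psdmx (- N)
    & (forall i, 0 <= a i + b i) ->
      (forall i, (a i * b i)%:C - (D^t* *m D) i i < 0) ->
      forall nu : 'M[R[i]]_(n + n) -> R,
        symmetric_norm nu -> induced_norm nu (A + B) < nu N].

Proof.
move=> A B N.
have i0 : 'I_n := Ordinal n_gt0.
have /diag_mxP [dv DE] := D_diag.
have {}DE : D = diag_mx (\row_i dv 0 i).
  by rewrite DE; congr diag_mx; apply/rowP => i; rewrite mxE.
have Nll i : N (lshift n i) (lshift n i) = (a i)%:C.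
  by rewrite block_mxEul !mxE eqxx.
have Nlr i : N (lshift n i) (rshift n i) = dv 0 i.
  by rewrite block_mxEur DE !mxE eqxx.
have Nrl i : N (rshift n i) (lshift n i) = (dv 0 i)^*%R.
  by rewrite block_mxEdl DE !mxE eqxx.
have Nrr i : N (rshift n i) (rshift n i) = (b i)%:C.
  by rewrite block_mxEdr !mxE eqxx.
split.
- move=> /(@psdmx_principal2 _ _ _ (lshift n i0) (rshift n i0) 0 1).
  rewrite Nrr !rmorph0 !rmorph1 !(mul0r, mulr0, add0r, mul1r, mulr1).
  by rewrite ler0c leNgt b_lt0.
- move=> AD0 psd; apply: AD0.
  have oppN p q : (- N) p q = - N p q by rewrite mxE.
  have form i x y :=
    @psdmx_principal2 _ _ _ (lshift n i) (rshift n i) x y psd.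
  have a0 i : a i = 0.
    apply/eqP; rewrite eq_le a_ge0 andbT -oppr_ge0 -ler0c.
    have := form i 1 0; rewrite !oppN Nll.
    by rewrite !rmorph0 !rmorph1 !(mul0r, mulr0, addr0, mul1r, mulr1) rmorphN.
  have d0 i : dv 0 i = 0.
    set e := complex.Re (dv 0 i) ^+ 2 + complex.Im (dv 0 i) ^+ 2.
    have ddE : dv 0 i * (dv 0 i)^*%R = e%:C by rewrite mulC_conj_real.
    suff e0 : e = 0.
      by apply/eqP; move/eqP: ddE; rewrite e0 mulf_eq0 conjC_eq0 orbb.
    (* As [a i = 0], the form of [- N] at this vector is [2 b e^2 - b e^2 = b e^2] with
       [b = b i < 0], which forces [e = 0]. *)
    have := form i (- (b i)%:C * dv 0 i) e%:C.
    have -> : (- (b i)%:C * dv 0 i)^*%R = - (b i)%:C * (dv 0 i)^*%R.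
      by rewrite rmorphM rmorphN; congr (- _ * _); exact: conjC_real_complex.
    rewrite !oppN Nll Nlr Nrl Nrr a0 conjC_real_complex.
    rewrite (_ : _ + _ = (b i * e ^+ 2)%:C); last first.
      by rewrite rmorphM rmorphXn /= -ddE; ring.
    rewrite ler0c nmulr_rge0 // => e2.
    by apply/eqP; rewrite -sqrf_eq0 eq_le e2 sqr_ge0.
  split.
    by apply/matrixP => p q; rewrite !mxE a0 mul0rn.
  by rewrite DE; apply/matrixP => p q; rewrite !mxE d0 mul0rn.
move=> ab0 det0 nu nuS; have [nuN nuU] := nuS.
have /fin_all_exists [t tP] : forall i, exists t : R * R * R * R[i],
    let: (l, mu, c, s) := t in
    [/\ a i + b i < l, c%:C * c%:C + s * s^*%R = 1,
        (a i)%:C * c%:C + dv 0 i * s^*%R = c%:C * l%:C,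
        dv 0 i * c%:C - (a i)%:C * s = - s * mu%:C &
        (dv 0 i)^*%R * c%:C + (b i)%:C * s^*%R = s^*%R * l%:C /\
        (b i)%:C * c%:C - (dv 0 i)^*%R * s = c%:C * mu%:C].
  move=> i; apply: hermitian2_diag => //.
  have := det0 i; rewrite DE adjmx_diag mulmx_diag !mxE eqxx.
  by rewrite mulr1n.
pose l i := (t i).1.1.1; pose mu i := (t i).1.1.2.
have lt_l i : a i + b i < l i.
  by move: (tP i); rewrite /l; case: (t i) => [[[? ?] ?] ?] [].
have [U Uu UE] : exists2 U : 'M[R[i]]_(n + n), U \is unitarymx &
    U^t* *m N *m U = block_mx (realdiag l) 0 0 (realdiag mu).
  rewrite /N DE; apply: (@unitary_block_diag _ _ _ _ _ _ (fun i => (t i).1.2)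
    _ (fun i => (t i).2)) => i; move: (tP i); rewrite /l /mu;
    by case: (t i) => [[[? ?] ?] ?] [? ? ? ? []].
have nuN_gt0 : 0 < nu N.
  apply: mxnorm_gt0 => //; apply/eqP => N0.
  have := b_lt0 i0; have := Nrr i0; rewrite N0 mxE => /esym/complexI ->.
  by rewrite ltxx.
have l0 i : 0 < l i := le_lt_trans (ab0 i) (lt_l i).
(* The largest ratio of [a i + b i] to [l i]. The default [1/2] keeps [q] positive when all ratios
   vanish, so that dividing by [q] is safe, and still below 1. *)
pose q := \big[Order.max/2^-1]_i ((a i + b i) / l i).
have q0 : 0 < q.
  by apply: lt_le_trans (bigmax_ge_id _ _ _ _); rewrite invr_gt0 ltr0n.
have q1 : q < 1.
  apply: bigmax_lt => [|i _]; first lra.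
  by rewrite ltr_pdivrMr ?mul1r.
have le_q i : a i + b i <= q * l i.
  by rewrite -ler_pdivrMr //; apply: le_bigmax.
clearbody q.
(* Chosen so that [q * k * l i = a i + b i] on the first block, while the zeros on the second block
   erase the eigenvalues [mu]. *)
pose k (j : 'I_(n + n)) : R :=
  if split j is inl i then (a i + b i) / (q * l i) else 0.
have k01 j : 0 <= k j <= 1.
  rewrite /k; case: (split j) => [i|_]; last by rewrite lexx ler01.
  have ql0 : 0 < q * l i by rewrite mulr_gt0.
  by rewrite divr_ge0 ?(ltW ql0) //= ler_pdivrMr ?mul1r.
have -> : induced_norm nu (A + B) =
    nu (q%:C *: (diag_mx (\row_j (k j)%:C) *m (U^t* *m N *m U))).
  congr nu; rewrite UE.
  have -> : \row_j (k j)%:C =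
      row_mx (\row_i ((a i + b i) / (q * l i))%:C) 0 :> 'rV[R[i]]_(n + n).
    apply/rowP => j; rewrite !mxE /k.
    by case: (split j) => i; rewrite !mxE.
  rewrite diag_mx_row mulmx_block scale_block_mx [diag_mx 0]raddf0.
  rewrite !mulmx0 !mul0mx !addr0 !scaler0 mulmx_diag; congr block_mx.
  apply/matrixP => p r; rewrite !mxE; case: (p == r); last first.
    by rewrite !mulr0n addr0 mulr0.
  rewrite !mulr1n -!rmorphM -rmorphD; congr _%:C; field.
  by rewrite (gt_eqF q0) (gt_eqF (l0 p)).
rewrite (mxnormZ nuN _ (ltW q0)).
have Ua : U^t* \is unitarymx by rewrite trmxC_unitary.
have := symmetric_norm_contraction (U^t* *m N *m U) nuS k01.
rewrite (nuU _ _ _ Ua Uu) => le_nuN.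
by apply: le_lt_trans (ler_wpM2l (ltW q0) le_nuN) _; rewrite gtr_pMl.
Qed.
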